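(* Let $D \subset \mathbb{R}^n$ be a bounded and measurable set, let $f : D \to \mathbb{R}$ be bounded, positive and measurable on $D$, and let $(\phi_k)_{k\ge 1}$ be a sequence of measurable functions $\phi_k : D \to \mathbb{R}$ with $0<\int_D \frac{\phi_k^2}{f}\,d\mu<\infty$ for all $k$, which are mutually orthogonal on $D$ with respect to $\frac1f$. Define $$c_k := \frac{\int_D \phi_k\,d\mu}{\int_D \frac{\phi_k^2}{f}\,d\mu},$$ and assume that the Fourier expansion of $f$ exists, i.e. $f = \sum_{k=1}^{\infty} c_k \phi_k$. Then $$\sum_{k=1}^{\infty} c_k^2 \int_D \frac{\phi_k^2}{f}\,d\mu \;=\; \int_D f\,d\mu.$$
   Context: $\mu$ is Lebesgue measure on $\mathbb{R}^n$; measurability and integrals are in the sense of Lebesgue. Functions $(\phi_k)$ are mutually orthogonal on $D$ with respect to $\frac1f$ if $\int_D \phi_j \phi_k \cdot \frac{1}{f}\,d\mu = 0$ for all $j \ne k$. The Fourier expansion $f=\sum_{k=1}^\infty c_k\phi_k$ is understood in the mean-square sense: $\int_D \left(f-\sum_{k=1}^N c_k\phi_k\right)^2\frac{1}{f}\,d\mu \to 0$ as $N\to\infty$. *)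

(* Defs.v *)
From HB Require Import structures.
From mathcomp Require Import all_boot all_order all_algebra.
From mathcomp Require Import all_classical all_reals all_analysis.

Set Implicit Arguments.
Unset Strict Implicit.
Unset Printing Implicit Defensive.

Import Order.TTheory GRing.Theory Num.Theory.
Import numFieldNormedType.Exports.

Local Open Scope classical_set_scope.
Local Open Scope ring_scope.
Local Open Scope ereal_scope.

Section lebesgue_outer_measure.
Context {R : realType} {n : nat}.
Implicit Types (a b : 'rV[R]_n) (A : set 'rV[R]_n).

Definition box a b : set 'rV[R]_n :=
  [set x | forall i, (a ord0 i <= x ord0 i <= b ord0 i)%R].

(* The maximum gives volume 0 to [box a b] when it is empty because
   [b ord0 i < a ord0 i] for some [i]. *)
Definition box_volume a b : R :=
  (\prod_i Num.max 0 (b ord0 i - a ord0 i))%R.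

(* Infimum of the total volumes of the countable families of boxes that cover
   [A]. The index set [I] makes the empty family available, without which the
   empty subset of R^0 would get outer measure +oo. *)
Definition lebesgue_outer A : \bar R :=
  ereal_inf [set v : \bar R |
    exists (I : set nat) (a b : nat -> 'rV[R]_n),
      A `<=` \bigcup_(k in I) box (a k) (b k) /\
      v = \esum_(k in I) (box_volume (a k) (b k))%:E].

Lemma box_volume_ge0 a b : (0 <= box_volume a b)%R.
Proof. by apply: prodr_ge0 => i _; rewrite le_max lexx. Qed.

Lemma lebesgue_outer_ge0 A : 0 <= lebesgue_outer A.
Proof.
apply: le_ereal_inf_tmp => _ [I [a [b [_ ->]]]].
by apply: esum_ge0 => k _; rewrite lee_fin box_volume_ge0.
Qed.

Lemma lebesgue_outer0 : lebesgue_outer set0 = 0.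
Proof.
apply/eqP; rewrite eq_le lebesgue_outer_ge0 andbT.
apply: ereal_inf_lbound; exists set0, (fun=> 0%R), (fun=> 0%R).
by split; [exact: sub0set | rewrite esum_set0].
Qed.

Lemma le_lebesgue_outer :
  {homo lebesgue_outer : A B / A `<=` B >-> A <= B}.
Proof.
move=> A B AB; apply: ereal_inf_le_tmp => v [I [a [b [BI ->]]]].
by exists I, a, b; split => //; exact: subset_trans BI.
Qed.

Lemma lebesgue_outer_sigma_subadditive : sigma_subadditive lebesgue_outer.
Proof.
move=> A; have [[i ioo]|] := pselect (exists i, lebesgue_outer (A i) = +oo).
  rewrite (eseries_pinfty _ _ ioo) ?leey// => k _.
  by rewrite -ltNye (lt_le_trans _ (lebesgue_outer_ge0 _)).
rewrite -forallNE => Aoo.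
suff add2e (e : {posnum R}) : lebesgue_outer (\bigcup_k A k) <=
    \sum_(i <oo) lebesgue_outer (A i) + e%:num%:E.
  by apply/lee_addgt0Pr => _/posnumP[].
rewrite (le_trans _ (epsilon_trick _ _ _))//; last first.
  by move=> k; exact: lebesgue_outer_ge0.
pose P k (G : set nat * ((nat -> 'rV[R]_n) * (nat -> 'rV[R]_n))) :=
  A k `<=` \bigcup_(j in G.1) box (G.2.1 j) (G.2.2 j) /\
  \esum_(j in G.1) (box_volume (G.2.1 j) (G.2.2 j))%:E <=
    lebesgue_outer (A k) + (e%:num / (2 ^ k.+1)%:R)%:E.
have [G PG] : {G & forall k, P k (G k)}.
  apply: (@choice _ _ P) => k.
  have fA : lebesgue_outer (A k) \is a fin_num.
    by rewrite ge0_fin_numE ?lebesgue_outer_ge0// ltey; apply/eqP/Aoo.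
  have e0 : (0 < e%:num / (2 ^ k.+1)%:R)%R by [].
  have [v [I [a [b [AI ->]]]] vlt] := lb_ereal_inf_adherent e0 fA.
  by exists (I, (a, b)); split => //=; exact: ltW.
have /card_esym/ppcard_eqP[f] := card_nat2.
pose vol (ij : nat * nat) :=
  (box_volume ((G ij.1).2.1 ij.2) ((G ij.1).2.2 ij.2))%:E.
pose I := [set k | (G (f k).1).1 (f k).2].
apply: (@le_trans _ _ (\esum_(k in I) vol (f k))).
  apply: ereal_inf_lbound; exists I.
  exists (fun k => (G (f k).1).2.1 (f k).2), (fun k => (G (f k).1).2.2 (f k).2).
  split => // x [i _ /(PG i).1 [j Gij xij]].
  by exists (f^-1%FUN (i, j)); rewrite /I/= invK ?inE.
have vol0 ij : 0 <= vol ij by rewrite lee_fin box_volume_ge0.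
have bij : set_bij I ([set: nat] `*`` (fun i => (G i).1)) f.
  split.
  - by move=> k Ik; split.
  - by move=> k l _ _; apply: inj; rewrite inE.
  - by move=> [i j] [_ /= Gij]; exists (f^-1%FUN (i, j)); rewrite /I/= invK ?inE.
rewrite -(reindex_esum _ _ _ _ bij) ?esum_esum//.
rewrite nneseries_esumT; last first.
  by move=> k; rewrite adde_ge0// ?lebesgue_outer_ge0// lee_fin.
have -> : \esum_(ij in [set: nat] `*`` (fun i => (G i).1)) vol ij =
    \esum_(i in [set: nat]) \esum_(j in (G i).1) vol (i, j).
  by rewrite esum_esum//; apply: eq_esum => -[].
by apply: le_esum => i _; exact: (PG i).2.
Qed.

HB.instance Definition _ := isOuterMeasure.Build R 'rV[R]_n lebesgue_outer
  lebesgue_outer0 lebesgue_outer_ge0 le_lebesgue_outer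
  lebesgue_outer_sigma_subadditive.

End lebesgue_outer_measure.

(* ['rV[R]_n] with the Lebesgue (Caratheodory) sigma-algebra. *)
Definition Rn (R : realType) (n : nat) : measurableType _ :=
  caratheodory_type (@lebesgue_outer R n).

Definition lebesgue_Rn {R : realType} {n : nat} : set (Rn R n) -> \bar R :=
  @lebesgue_outer R n.

Section lebesgue_Rn_measure.
Context {R : realType} {n : nat}.

Let lebesgue_Rn0 : @lebesgue_Rn R n set0 = 0.
Proof. exact: lebesgue_outer0. Qed.

Let lebesgue_Rn_ge0 (A : set (Rn R n)) : 0 <= lebesgue_Rn A.
Proof. exact: lebesgue_outer_ge0. Qed.

Let lebesgue_Rn_semi_sigma_additive : semi_sigma_additive (@lebesgue_Rn R n).
Proof.
exact: (@caratheodory_measure_sigma_additive _ _ (@lebesgue_outer R n)).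
Qed.

HB.instance Definition _ := isMeasure.Build _ _ _ (@lebesgue_Rn R n)
  lebesgue_Rn0 lebesgue_Rn_ge0 lebesgue_Rn_semi_sigma_additive.

End lebesgue_Rn_measure.

Section weighted_fourier.
Context {R : realType} {n : nat}.
Local Notation mu := (@lebesgue_Rn R n).
Implicit Types (D : set (Rn R n)) (f w : Rn R n -> R) (phi : nat -> Rn R n -> R).

Definition mutually_orthogonal D w phi : Prop :=
  forall j k, j <> k -> \int[mu]_(x in D) (phi j x * phi k x * w x)%:E = 0.

Definition fourier_coef D f phi (k : nat) : R :=
  ((\int[mu]_(x in D) phi k x) / (\int[mu]_(x in D) (phi k x ^+ 2 / f x)))%R.

Definition mean_square_expansion D w f (c : nat -> R) phi : Prop :=
  \int[mu]_(x in D) ((f x - \sum_(k < N) c k * phi k x) ^+ 2 * w x)%:E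
    @[N --> \oo] --> 0.

End weighted_fourier.

(* Main.v *)
Require Import Defs.
From mathcomp Require Import all_boot all_order all_algebra.
From mathcomp Require Import all_classical all_reals all_analysis.
From mathcomp Require Import measurable_realfun ring lra.
Import Order.TTheory GRing.Theory Num.Theory.
Import numFieldNormedType.Exports.
Local Open Scope classical_set_scope.
Local Open Scope ring_scope.

(** This is Parseval's identity in the Hilbert space of functions on [D] that
    are square-integrable for the weight [w = 1 / f]. Two remarks turn the
    statement into it. First, [f * f * w = f] and [f * phi k * w = phi k] on
    [D], so that the integral of [f] is the squared weighted norm of [f], and
    the numerator of the [k]-th Fourier coefficient is the weighted inner
    product of [f] and [phi k]. Second, [f] belongs to the space: a bounded
    set is contained in a cube, hence has finite measure, and so the bounded
    function [f] is integrable on it ([lebesgue_outer_bounded]).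

    In the Hilbert space, the residual of order [N], that is [f] minus the first
    [N] terms of its expansion, has the same inner product as [f] with every
    later [phi k] ([residual_wdot]). Hence the term of index [N] is the
    orthogonal projection of the residual of order [N] on the line spanned by [phi N], and
    subtracting it decreases the squared norm of the residual by exactly the
    squared norm of that term. This gives Bessel's identity
    ([bessel_identity]); as the residuals tend to [0] in mean square, the
    partial sums of the series tend to the squared norm of [f] ([parseval]). *)

Section weighted_square_integrable.
Set Implicit Arguments.
Unset Strict Implicit.
Context d (T : measurableType d) (R : realType).
Variables (mu : {measure set T -> \bar R}) (D : set T) (w : T -> R).
Hypothesis mD : measurable D.
Hypothesis mw : measurable_fun D w.
Hypothesis w_ge0 : forall x, D x -> 0 <= w x.
Implicit Types g h : T -> R.

Definition square_integrable g : Prop :=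
  measurable_fun D g /\ mu.-integrable D (fun x => (g x ^+ 2 * w x)%:E).

Definition wdot g h : R := \int[mu]_(x in D) (g x * h x * w x).

(** Integrability of a product follows from the pointwise bound
    [`|a * b| <= a ^+ 2 + b ^+ 2]. *)
Lemma square_integrableM g h : square_integrable g -> square_integrable h ->
  mu.-integrable D (fun x => (g x * h x * w x)%:E).
Proof.
move=> [mg ig] [mh ih]; apply: le_integrable (integrableD mD ig ih) => //.
  by apply/measurable_EFinP; do 2 apply: measurable_funM => //.
move=> x Dx /=; rewrite lee_fin normrM (ger0_norm (w_ge0 Dx)).
rewrite [leRHS]ger0_norm; last first.
  by rewrite -mulrDl mulr_ge0 ?w_ge0// addr_ge0 ?sqr_ge0.
rewrite -mulrDl ler_wpM2r ?w_ge0// ler_norml; apply/andP; split; nra.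
Qed.

Lemma square_integrableBZ a g h : square_integrable g -> square_integrable h ->
  square_integrable (fun x => g x - a * h x).
Proof.
move=> L2g L2h; have [[mg ig] [mh ih]] := (L2g, L2h); split.
  by apply: measurable_funB => //; apply: measurable_funM.
have igh := square_integrableM L2g L2h.
have isum := integrableD mD (integrableD mD ig
  (integrableZl mD (- 2 * a) igh)) (integrableZl mD (a ^+ 2) ih).
apply: (eq_integrable mD _ _ _ isum) => x _ /=.
by rewrite -!EFinM -!EFinD; congr EFin; ring.
Qed.

Lemma wdotC g h : wdot g h = wdot h g.
Proof. by apply: eq_Rintegral => x _; rewrite (mulrC (g x)). Qed.

Lemma wdotBZl a g h u :
    square_integrable g -> square_integrable h -> square_integrable u ->
  wdot (fun x => g x - a * h x) u = wdot g u - a * wdot h u.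
Proof.
move=> L2g L2h L2u; have igu := square_integrableM L2g L2u.
have ihu := square_integrableM L2h L2u.
rewrite /wdot -(RintegralZl a mD ihu) -RintegralB//; last first.
  exact: (integrableZl mD a ihu).
by apply: eq_Rintegral => x _; ring.
Qed.

Section orthogonal_expansion.
Variables (f : T -> R) (phi : nat -> T -> R).
Hypothesis L2f : square_integrable f.
Hypothesis L2phi : forall k, square_integrable (phi k).
Hypothesis phi_neq0 : forall k, wdot (phi k) (phi k) != 0.
Hypothesis phi_orth : forall j k, j <> k -> wdot (phi j) (phi k) = 0.

Let c k := wdot f (phi k) / wdot (phi k) (phi k).

Definition residual N x := f x - \sum_(k < N) c k * phi k x.

Lemma residualS N :
  residual N.+1 = fun x => residual N x - c N * phi N x.
Proof. by apply/funext => x; rewrite /residual big_ord_recr opprD addrA. Qed.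

Lemma residual_square_integrable N : square_integrable (residual N).
Proof.
elim: N => [|N IHN]; last by rewrite residualS; exact: square_integrableBZ.
suff -> : residual 0 = f by [].
by apply/funext => x; rewrite /residual big_ord0 subr0.
Qed.

Lemma residual_wdot N k : (N <= k)%N ->
  wdot (residual N) (phi k) = wdot f (phi k).
Proof.
elim: N => [_|N IHN Nk].
  by apply: eq_Rintegral => x _; rewrite /residual big_ord0 subr0.
rewrite residualS wdotBZl ?IHN ?(ltnW Nk)//; last first.
  exact: residual_square_integrable.
by rewrite phi_orth ?mulr0 ?subr0// => NEk; rewrite NEk ltnn in Nk.
Qed.

Lemma bessel_identity N :
  wdot (residual N) (residual N) =
  wdot f f - \sum_(k < N) c k ^+ 2 * wdot (phi k) (phi k).
Proof.
elim: N => [|N IHN].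
  by rewrite big_ord0 subr0; apply: eq_Rintegral => x _;
     rewrite /residual big_ord0 subr0.
have L2r := residual_square_integrable.
have L2rS : square_integrable (fun x => residual N x - c N * phi N x).
  exact: square_integrableBZ.
rewrite residualS wdotBZl// (wdotC (residual N)) (wdotC (phi N)) !wdotBZl//.
rewrite IHN big_ord_recr/= (wdotC (phi N) (residual N)) residual_wdot//.
(* Expressed through [c N], the two mixed terms equal the quadratic one. *)
have -> : wdot f (phi N) = c N * wdot (phi N) (phi N) by rewrite divfK.
by ring.
Qed.

Lemma parseval :
  wdot (residual N) (residual N) @[N --> \oo] --> 0 ->
  \sum_(k < N) c k ^+ 2 * wdot (phi k) (phi k) @[N --> \oo] --> wdot f f.
Proof.
move=> r0; rewrite -[wdot f f]subr0.
have -> : (fun N => \sum_(k < N) c k ^+ 2 * wdot (phi k) (phi k)) =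
    (fun N => wdot f f - wdot (residual N) (residual N)).
  by apply/funext => N; rewrite bessel_identity subKr.
by apply: cvgB => //; exact: cvg_cst.
Qed.

End orthogonal_expansion.
End weighted_square_integrable.

(** A ball for the maximum norm lies in a cube, and a single box is already a
    countable cover. *)
Lemma lebesgue_outer_bounded (R : realType) (n : nat) (A : set 'rV[R]_n) :
  bounded_set A -> (lebesgue_outer A < +oo)%E.
Proof.
move=> [M [_ bM]].
(* The hypothesis gives the bound only for constants greater than [M]. *)
have {}bM : forall x, A x -> `|x| <= M + 1 by apply: bM; rewrite ltrDl.
pose a : 'rV[R]_n := const_mx (- (M + 1)).
pose b : 'rV[R]_n := const_mx (M + 1).
apply: (@le_lt_trans _ _ (box_volume a b)%:E); last exact: ltry.
apply: ereal_inf_lbound.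
exists [set 0%N], (fun=> a), (fun=> b); split; last first.
  by rewrite esum_set1// lee_fin box_volume_ge0.
move=> x Ax; exists 0%N => // i; rewrite !mxE -ler_norml.
apply: le_trans (bM x Ax).
rewrite [leRHS]mx_normrE.
exact: (le_bigmax _ (fun ij : 'I_1 * 'I_n => `|x ij.1 ij.2|) (ord0, i)).
Qed.

(** On positive reals, inversion is the real power of exponent [-1], and real
    powers are measurable on the whole line. *)
Lemma measurable_fun_inv_pos d (T : measurableType d) (R : realType)
    (D : set T) (f : T -> R) : (forall x, D x -> 0 < f x) ->
  measurable_fun D f -> measurable_fun D (fun x => (f x)^-1).
Proof.
move=> f0 mf; apply: (eq_measurable_fun (fun x => f x `^ (-1))).
  by move=> x; rewrite inE => Dx; rewrite powR_inv1// ltW// f0.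
exact: measurableT_comp (measurable_powR _) mf.
Qed.

Theorem lemma3p1 (R : realType) (n : nat) (D : set (Rn R n))
    (f : Rn R n -> R) (phi : nat -> Rn R n -> R)
    (D_bounded : bounded_set (D : set 'rV[R]_n))
    (D_measurable : measurable D)
    (f_bounded : [bounded f x : R^o | x in D])
    (f_positive : forall x, D x -> 0 < f x)
    (f_measurable : measurable_fun D f)
    (phi_measurable : forall k, measurable_fun D (phi k))
    (phi_norm : forall k,
      (0 < \int[@lebesgue_Rn R n]_(x in D) (phi k x ^+ 2 / f x)%:E < +oo)%E)
    (phi_orthogonal : mutually_orthogonal D (fun x => (f x)^-1) phi)
    (f_expansion : mean_square_expansion D (fun x => (f x)^-1) f
      (fourier_coef D f phi) phi) :
  (\sum_(0 <= k <oo) (fourier_coef D f phi k ^+ 2)%:E *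
      \int[@lebesgue_Rn R n]_(x in D) (phi k x ^+ 2 / f x)%:E
    = \int[@lebesgue_Rn R n]_(x in D) (f x)%:E)%E.
Proof.
set mu := @lebesgue_Rn R n.
pose w x := (f x)^-1.
have mw : measurable_fun D w by exact: measurable_fun_inv_pos.
have w_ge0 x : D x -> 0 <= w x by move=> Dx; rewrite invr_ge0 ltW ?f_positive.
have fw x : D x -> f x * w x = 1.
  by move=> Dx; rewrite mulfV// gt_eqF// f_positive.
have intf : mu.-integrable D (EFin \o f).
  apply: measurable_bounded_integrable => //.
  exact: lebesgue_outer_bounded.
have L2f : square_integrable mu D w f.
  split => //; apply: (eq_integrable D_measurable) intf => x.
  by rewrite inE => Dx /=; rewrite expr2 -mulrA fw// mulr1.
have L2phi k : square_integrable mu D w (phi k).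
  split => //; apply/integrableP; split.
    by apply/measurable_EFinP; apply: measurable_funM => //;
       exact: measurable_funX.
  under eq_integral => x.
    rewrite inE => Dx.
    rewrite gee0_abs; last by rewrite lee_fin mulr_ge0 ?sqr_ge0 ?w_ge0.
    over.
  by have /andP[] := phi_norm k.
have phi_sqE k : (wdot mu D w (phi k) (phi k))%:E =
    (\int[mu]_(x in D) (phi k x ^+ 2 / f x)%:E)%E.
  rewrite fineK; last first.
    apply: integrable_fin_num => //.
    exact: (square_integrableM D_measurable mw w_ge0 (L2phi k) (L2phi k)).
  by apply: eq_integral => x _; rewrite expr2.
have phi_neq0 k : wdot mu D w (phi k) (phi k) != 0.
  have /andP[+ _] := phi_norm k.
  by rewrite -phi_sqE lte_fin => /lt0r_neq0.
have phi_orth j k : j <> k -> wdot mu D w (phi j) (phi k) = 0.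
  by move=> jk; rewrite /wdot /Rintegral phi_orthogonal.
have wdot_ff : (wdot mu D w f f)%:E = (\int[mu]_(x in D) (f x)%:E)%E.
  rewrite -[RHS]fineK ?integrable_fin_num//; congr EFin.
  by apply: eq_Rintegral => x; rewrite inE => Dx; rewrite -mulrA fw// mulr1.
have coefE k : fourier_coef D f phi k =
    wdot mu D w f (phi k) / wdot mu D w (phi k) (phi k).
  congr (_ / _); apply: eq_Rintegral => x; rewrite inE => Dx.
  by rewrite mulrAC fw// mul1r.
have residualE N x : residual mu D w f phi N x =
    f x - \sum_(k < N) fourier_coef D f phi k * phi k x.
  by congr (_ - _); apply: eq_bigr => k _; rewrite coefE.
have r0 : wdot mu D w (residual mu D w f phi N) (residual mu D w f phi N)
    @[N --> \oo] --> 0.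
  have /fine_cvgP[_] := f_expansion; apply: cvg_trans; apply: near_eq_cvg.
  by apply: nearW => N; apply: eq_Rintegral => x _; rewrite !residualE expr2.
have := parseval D_measurable mw w_ge0 L2f L2phi phi_neq0 phi_orth r0.
under eq_eseriesr do rewrite coefE -phi_sqE -EFinM.
rewrite -wdot_ff => cvg_sum; apply: cvg_lim => //.
apply: cvg_EFin; first by apply: nearW => N; rewrite sumEFin.
apply: cvg_trans cvg_sum; apply: near_eq_cvg; apply: nearW => N /=.
by rewrite sumEFin big_mkord.
Qed.
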